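(* Let $a$ be a fixed positive natural number. Let $f$ be a function on the positive integers with $f(n)>0$ for all $n$ and $f(n)=o(n^{-3/2})$ as $n\to\infty$, and for each $n$ let $n$ sensors have common range $r=r(n)=\frac{1}{2n}+\frac{f(n)}{2}$. Then $$E^{(a)}(r)\in\Theta\left(\frac{1}{n^{\frac{a}{2}-1}}\right)\qquad (n\to\infty).$$
   Context: Setting: $n$ sensors are placed independently and uniformly at random in the unit interval $[0,1]$; call their initial positions $U_1,\dots,U_n$. A sensor with range $r>0$ located at position $y$ covers every point at distance at most $r$ from $y$, i.e. the interval $[y-r,y+r]$. Final positions $b_1,\dots,b_n$ on the line attain coverage if $[0,1]\subseteq\bigcup_{i=1}^n[b_i-r,b_i+r]$. Definition: for a positive natural number $a$ and range $r\ge \frac{1}{2n}$, $E^{(a)}(r)$ denotes the expected minimum sum of displacements to the power $a$ of the $n$ sensors with range $r$ needed to attain coverage of $[0,1]$, i.e. the expectation, over the random initial positions, of $$\min\left\{\sum_{i=1}^n|U_i-b_i|^a : b_1,\dots,b_n \text{ attain coverage of } [0,1]\right\}.$$ The implied constants in $\Theta(\cdot)$ do not depend on $n$. *)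

(* Defs.v *)
(* MathComp-Analysis. *)
From mathcomp Require Import all_boot all_order all_algebra.
From mathcomp Require Import all_classical all_reals all_analysis.

Set Implicit Arguments.
Unset Strict Implicit.
Unset Printing Implicit Defensive.

Import Order.TTheory GRing.Theory Num.Theory.
Import numFieldNormedType.Exports.

Local Open Scope classical_set_scope.
Local Open Scope ring_scope.

Section Sensors.
Context {R : realType} {n : nat}.

Definition attains_coverage (r : R) (b : 'I_n -> R) : Prop :=
  `[0, 1]%classic `<=` \bigcup_(i in [set: 'I_n]) `[b i - r, b i + r]%classic.

Definition displacement_cost (a : nat) (u b : 'I_n -> R) : R :=
  \sum_(i < n) `|u i - b i| ^+ a.

(* For 0 < n, 0 < a and (2 * n)^-1 <= r the set below is nonempty, and by compactness
   the infimum is a minimum: the covering configurations form a closed set and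
   the cost is continuous and coercive in b. *)
Definition min_displacement_cost (a : nat) (r : R) (u : 'I_n -> R) : R :=
  inf [set displacement_cost a u b | b in attains_coverage r].

End Sensors.

Section RandomSensors.
Context {d : measure_display} {T : measurableType d} {R : realType} {n : nat}.
Variable P : probability T R.

Definition mutually_independent (U : 'I_n -> {RV P >-> R}) : Prop :=
  forall (J : {set 'I_n}) (A : 'I_n -> set R),
    (forall i, measurable (A i)) ->
    P (\bigcap_(i in [set` J]) (U i @^-1` A i)) =
      (\prod_(i in J) P (U i @^-1` A i))%E.

Definition uniform01 (X : {RV P >-> R}) : Prop :=
  forall A : set R, measurable A ->
    distribution P X A = uniform_prob (@ltr01 R) A.

(* E^(a)(r): it depends only on the joint law of U, hence only on n, a and r
   when U is a family of n independent uniform positions. *)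
Definition expected_min_cost (a : nat) (r : R) (U : 'I_n -> {RV P >-> R})
    : \bar R :=
  'E_P[fun w : T => min_displacement_cost a r (fun i => U i w)].

End RandomSensors.

(* Main.v *)
Require Import Defs.
From mathcomp Require Import all_boot all_order all_algebra.
From mathcomp Require Import all_classical all_reals all_analysis.
From mathcomp Require Import measurable_realfun ring lra zify.

Set Implicit Arguments.
Unset Strict Implicit.
Unset Printing Implicit Defensive.

Import Order.TTheory GRing.Theory Num.Theory.
Import numFieldNormedType.Exports.

Local Open Scope classical_set_scope.
Local Open Scope ring_scope.

(** Write [h = n^(-1/2)], [N p] for the number of sensors starting in [(-oo, p]];
    every estimate on the random positions is an expectation of a function of
    some [N p], which is binomial with parameters [n] and [p].

    Upper bound: send the sensor of rank [k] to the anchor [t = (k + 1/2) / n].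
    If it starts to the right of [t + l h] then [N (t + l h) <= k], a deviation of
    [N] by [l sqrt n] from its mean, of probability [O(e^(-l))] by Chernoff.  Hence
    each displacement has [a]-th moment [O(h^a)].

    Lower bound: in a covering, at least [x / (2 r)] sensors end in
    [(-oo, x + r]], whatever [x <= 1].  As [2 r n = 1 + o(n^(-1/2))], for [p] in
    [[1/4, 3/4]] and [dl = h / 256] the number of sensors that start to the right of
    [p] and end to the left of [p - dl] is at least [n p - sqrt n / 128 - N p],
    whose positive part has mean of order [sqrt n].  Summing over the levels
    [p = 1/4 + j dl], a sensor crossing [c] of them moves by at least [c dl], so it
    costs at least [dl^a c]; there are of order [sqrt n] levels, so the total cost is
    at least of order [dl^a n]. *)

(** * Moments and exponential moments of the binomial distribution *)

Section BinomialMean.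
Context {R : realType}.
Implicit Types (p x l : R) (n : nat) (h : nat -> R).

(** The sum runs over subsets because [J] stands for the exact set of sensors starting at or left of
    a point, an event whose probability comes from independence. *)
Definition binomial_mean p n h : R :=
  \sum_(J : {set 'I_n}) p ^+ #|J| * (1 - p) ^+ (n - #|J|) * h #|J|.

Lemma binomial_mean_binE p n h :
  binomial_mean p n h =
  \sum_(k < n.+1) 'C(n, k)%:R * (p ^+ k * (1 - p) ^+ (n - k) * h k).
Proof.
rewrite /binomial_mean.
rewrite (partition_big (fun J : {set 'I_n} => inord #|J| : 'I_n.+1) xpredT)//=.
apply: eq_bigr => k _.
have cardE (J : {set 'I_n}) : (inord #|J| == k :> 'I_n.+1) = (#|J| == k).
  rewrite -val_eqE/= inordK// ltnS.
  by have := max_card (mem J); rewrite card_ord.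
under eq_bigl do rewrite cardE.
rewrite (eq_bigr (fun=> p ^+ k * (1 - p) ^+ (n - k) * h k)); last first.
  by move=> J /eqP ->.
rewrite sumr_const mulr_natl; congr (_ *+ _).
have := card_draws 'I_n k; rewrite card_ord cardsE => <-.
by apply: eq_card => J; rewrite unfold_in.
Qed.

Lemma binomial_mean0 p h : binomial_mean p 0 h = h 0%N.
Proof. by rewrite binomial_mean_binE big_ord_recl big_ord0 /= bin0 !expr0 !mul1r addr0. Qed.

(** Condition on one trial; on the sum by cardinality this is Pascal's rule. The moment formulas
    below follow by induction on [n], for every shift [x] at once, since a success turns [x] into
    [1 + x]. *)
Lemma binomial_meanS p n h : binomial_mean p n.+1 h =
  (1 - p) * binomial_mean p n h + p * binomial_mean p n (fun k => h k.+1).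
Proof.
rewrite !binomial_mean_binE !mulr_sumr.
pose F (k : nat) := (1 - p) * ('C(n, k)%:R * (p ^+ k * (1 - p) ^+ (n - k) * h k)).
have -> : \sum_(i < n.+1) (1 - p) * ('C(n, i)%:R * (p ^+ i * (1 - p) ^+ (n - i) * h i))
   = F 0%N + \sum_(i < n.+1) F i.+1.
  rewrite -(big_ord_recl n.+1 F) [RHS]big_ord_recr /=.
  by rewrite [F n.+1]/F bin_small// mul0r mulr0 addr0.
rewrite big_ord_recl -addrA -big_split /=; congr (_ + _).
  by rewrite /F !bin0 !subn0 !expr0 exprS; ring.
apply: eq_bigr => i _; rewrite /bump /= add1n binS natrD /F subSS.
(* The last index is treated apart because [n - i.+1] truncates there. *)
have [->|ilt] := eqVneq (i : nat) n.
  by rewrite (bin_small (ltnSn n)) subnn exprS; ring.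
have {}ilt : (i < n)%N by have := ltn_ord i; lia.
have -> : (n - i = (n - i.+1).+1)%N by lia.
by rewrite !exprS; ring.
Qed.

Lemma eq_binomial_mean p n h1 h2 : h1 =1 h2 ->
  binomial_mean p n h1 = binomial_mean p n h2.
Proof. by move=> e; apply: eq_bigr => J _; rewrite e. Qed.

Lemma le_binomial_mean p n h1 h2 : 0 <= p <= 1 -> (forall k, h1 k <= h2 k) ->
  binomial_mean p n h1 <= binomial_mean p n h2.
Proof.
move=> /andP[p0 p1] h12; apply: ler_sum => J _; apply: ler_wpM2l => //.
by rewrite mulr_ge0// exprn_ge0// subr_ge0.
Qed.

Lemma binomial_meanZ p n c h :
  binomial_mean p n (fun k => c * h k) = c * binomial_mean p n h.
Proof. by rewrite /binomial_mean mulr_sumr; apply: eq_bigr => J _; rewrite mulrCA. Qed.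

Lemma binomial_meanD p n h1 h2 :
  binomial_mean p n (fun k => h1 k + h2 k) =
  binomial_mean p n h1 + binomial_mean p n h2.
Proof. by rewrite /binomial_mean -big_split; apply: eq_bigr => J _; rewrite mulrDr. Qed.

Lemma binomial_mean_cst p n x : binomial_mean p n (fun=> x) = x.
Proof. by elim: n => [|n IH]; rewrite ?binomial_mean0// binomial_meanS IH; ring. Qed.

Lemma binomial_mean1 p n x :
  binomial_mean p n (fun k => k%:R + x) = n%:R * p + x.
Proof.
elim: n x => [|n IH] x; rewrite ?binomial_mean0 ?mul0r// binomial_meanS IH.
rewrite (@eq_binomial_mean _ _ _ (fun k => k%:R + (1 + x))); last first.
  by move=> k; rewrite -natr1; ring.
by rewrite IH -natr1; ring.
Qed.

Lemma binomial_mean2 p n x :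
  binomial_mean p n (fun k => (k%:R + x) ^+ 2) =
  (n%:R * p + x) ^+ 2 + n%:R * p * (1 - p).
Proof.
elim: n x => [|n IH] x; first by rewrite binomial_mean0; ring.
rewrite binomial_meanS IH.
rewrite (@eq_binomial_mean _ _ _ (fun k => (k%:R + (1 + x)) ^+ 2)); last first.
  by move=> k; rewrite -natr1; ring.
by rewrite IH -natr1; ring.
Qed.

(** Expansion of the mean of [(y + S)^4] for the centred count [S], whose moments of order 2, 3, 4
    are [v], [v (1 - 2 p)] and [v (1 + 3 (n - 2) p (1 - p))]. *)
Lemma binomial_mean4 p n x (y := n%:R * p + x) (v := n%:R * p * (1 - p)) :
  binomial_mean p n (fun k => (k%:R + x) ^+ 4) =
  y ^+ 4 + 6 * y ^+ 2 * v + 4 * y * v * (1 - 2 * p)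
  + v * (1 + 3 * (n%:R - 2) * p * (1 - p)).
Proof.
rewrite /y /v {y v}; elim: n x => [|n IH] x; first by rewrite binomial_mean0; ring.
rewrite binomial_meanS IH.
rewrite (@eq_binomial_mean _ _ _ (fun k => (k%:R + (1 + x)) ^+ 4)); last first.
  by move=> k; rewrite -natr1; ring.
by rewrite IH -natr1; ring.
Qed.

Lemma binomial_mean_expR p n l x :
  binomial_mean p n (fun k => expR (l * (k%:R + x))) =
  (1 - p + p * expR l) ^+ n * expR (l * x).
Proof.
elim: n x => [|n IH] x; first by rewrite binomial_mean0 add0r expr0 mul1r.
rewrite binomial_meanS IH.
rewrite (@eq_binomial_mean _ _ _ (fun k => expR (l * (k%:R + (1 + x))))); last first.
  by move=> k; rewrite -natr1; congr expR; ring.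
by rewrite IH mulrDr mulr1 expRD exprS; ring.
Qed.

(** Here [e^x <= 1 / (1 - x)], and [(1 - x) (1 + x + 2 x^2) = 1 + x^2 (1 - 2 x)]. *)
Lemma expR_le_quadratic x : x <= 2^-1 -> expR x <= 1 + x + 2 * x ^+ 2.
Proof.
move=> x2; have x1 : 0 < 1 - x by lra.
have := expR_ge1Dx (- x); rewrite expRN => e.
have : (1 - x) * expR x <= 1.
  by rewrite -ler_pdivlMr ?expR_gt0// div1r.
move=> {}e; rewrite -(ler_pM2l x1); apply: le_trans e _.
have : 0 <= x ^+ 2 * (1 - 2 * x) by rewrite mulr_ge0 ?sqr_ge0//; lra.
by nra.
Qed.

(* With [p * e^(l(1-p)) + (1-p) * e^(-lp) <= 1 + 2 l^2 <= e^(2 l^2)]. *)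
Lemma binomial_mgf_le p n l : 0 <= p <= 1 -> `|l| <= 2^-1 ->
  binomial_mean p n (fun k => expR (l * (k%:R - n%:R * p))) <=
  expR (2 * l ^+ 2 * n%:R).
Proof.
move=> /andP[p0 p1]; rewrite ler_norml => /andP[l0 l1].
rewrite binomial_mean_expR.
have -> : expR (l * - (n%:R * p)) = expR (- (l * p)) ^+ n.
  by rewrite -expRM_natl; congr expR; rewrite -mulr_natl; ring.
rewrite -exprMn -mulr_natr expRM_natr; apply: lerXn2r; rewrite ?nnegrE ?expR_ge0//.
  by rewrite mulr_ge0 ?expR_ge0// addr_ge0 ?subr_ge0// mulr_ge0 ?expR_ge0.
have e1 : expR (- (l * p)) <= 1 - l * p + 2 * (l * p) ^+ 2.
  by have := @expR_le_quadratic (- (l * p)); rewrite sqrrN; apply; nra.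
have e2 : expR (l * (1 - p)) <= 1 + l * (1 - p) + 2 * (l * (1 - p)) ^+ 2.
  by apply: expR_le_quadratic; nra.
apply: le_trans (expR_ge1Dx _).
have -> : (1 - p + p * expR l) * expR (- (l * p)) =
    (1 - p) * expR (- (l * p)) + p * expR (l * (1 - p)).
  by rewrite mulrDl -[p * _ * _]mulrA -expRD; congr (_ + p * expR _); ring.
have : (1 - p) * expR (- (l * p)) <= (1 - p) * (1 - l * p + 2 * (l * p) ^+ 2).
  by apply: ler_wpM2l; lra.
have : p * expR (l * (1 - p)) <= p * (1 + l * (1 - p) + 2 * (l * (1 - p)) ^+ 2).
  by apply: ler_wpM2l; lra.
have l2 : 0 <= l ^+ 2 by exact: sqr_ge0.
have : l ^+ 2 * (p * (1 - p)) <= l ^+ 2 by rewrite ler_piMr//; nra.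
by nra.
Qed.

End BinomialMean.

(** * Comparison of integrals and of measures *)

Section Integration.
Context {d : measure_display} {T : measurableType d} {R : realType}.
Local Open Scope ereal_scope.

(* Unlike [ge0_le_integral], no measurability is needed: the integral of a
   nonnegative function is a supremum over the simple functions below it. *)
Lemma le_integral_nonmeasurable (mu : {measure set T -> \bar R})
    (f g : T -> \bar R) :
  (forall x, 0 <= f x) -> (forall x, f x <= g x) ->
  \int[mu]_x f x <= \int[mu]_x g x.
Proof.
move=> f0 fg; rewrite !ge0_integralTE//; last first.
  by move=> x; exact: le_trans (f0 x) (fg x).
by apply: le_ereal_sup => _ [h hf <-]; exists h => // x; exact: le_trans (hf x) (fg x).
Qed.

(** Serves for the null event that some sensor starts outside [[0, 1]], and for the Lebesgue measure
    of an interval covered by sensors. *)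
Lemma measure_cover_le (mu : {measure set T -> \bar R}) (I : eqType)
    (s : seq I) (F : I -> set T) (A : set T) :
  measurable A -> (forall i, measurable (F i)) ->
  (forall x, A x -> exists2 i, i \in s & F i x) ->
  mu A <= \sum_(i <- s) mu (F i).
Proof.
move=> mA mF; elim: s A mA => [|i s IH] A mA Acover.
  rewrite (_ : A = set0) ?measure0 ?big_nil//.
  by apply/seteqP; split=> // x /Acover[].
rewrite big_cons; apply: (@le_trans _ _ (mu (F i `|` (A `\` F i)))).
  apply: le_measure; rewrite ?inE//.
    by apply: measurableU => //; exact: measurableD.
  by move=> x Ax; have [|] := pselect (F i x); [left|right].
apply: le_trans (measureU2 _ _ _) _ => //; first exact: measurableD.
rewrite leeD2l//; apply: IH; first exact: measurableD.
move=> x [/Acover[j]]; rewrite inE => /orP[/eqP ->//|js Fj _]; by exists j.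
Qed.

End Integration.

(** * Law of the number of sensors starting at or left of a point *)

Section UniformSample.
Context {d : measure_display} {T : measurableType d} {R : realType} {n : nat}.
Variables (P : probability T R) (U : 'I_n -> {RV P >-> R}).
Hypothesis U_unif : forall i, uniform01 (U i).
Hypothesis U_indep : mutually_independent U.

Definition sample_count (u : 'I_n -> R) (p : R) : nat := #|[set i | u i <= p]%SET|.

Lemma probability_uniform_le i (p : R) : 0 <= p <= 1 ->
  P (U i @^-1` `]-oo, p]) = p%:E.
Proof.
move=> /andP[p0 p1].
have := @U_unif i `]-oo, p]%classic (measurable_itv _).
rewrite /distribution /pushforward => ->.
rewrite /uniform_prob integral_uniform_pdf.
have -> : (`]-oo, p] `&` `[0, 1] = `[0, p] :> set R)%classic.
  by apply/seteqP; split=> x /=; rewrite !in_itv/= => H; lra.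
rewrite (eq_integral (cst 1%E)); last first.
  move=> x; rewrite inE/= in_itv/= => /andP[x0 xp].
  by rewrite /uniform_pdf x0 (le_trans xp p1)/= subr0 invr1.
rewrite integral_cst// mul1e [LHS]lebesgue_measure_itv/=.
by rewrite lte_fin; case: ltrgtP p0 => // [_|<-]; rewrite ?oppr0 ?adde0 ?sube0.
Qed.

Lemma probability_uniform_gt i (p : R) : 0 <= p <= 1 ->
  P (U i @^-1` `]p, +oo[) = (1 - p)%:E.
Proof.
move=> p01; have <- : (~` (U i @^-1` `]-oo, p]) = U i @^-1` `]p, +oo[)%classic.
  by rewrite preimage_setC setCitvl.
rewrite probability_setC ?probability_uniform_le//.
by rewrite -[X in measurable X]setTI; exact: measurable_funPT.
Qed.

Lemma probability_uniform_out i : P (U i @^-1` (~` `[0%R, 1%R]))%classic = 0.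
Proof.
have := @U_unif i (~` `[0%R, 1%R])%classic (measurableC (measurable_itv _)).
rewrite /distribution /pushforward => ->.
by rewrite /uniform_prob integral_uniform_pdf setICl integral_set0.
Qed.

Let E (p : R) (J : {set 'I_n}) : set T :=
  [set w | [set i | U i w <= p]%SET = J].

(** An intersection of preimages over all indices is the form to which independence applies. *)
Let EE p J : E p J = \bigcap_(i in [set` [set: 'I_n]%SET])
    (U i @^-1` (if i \in J then `]-oo, p]%classic else `]p, +oo[%classic)).
Proof.
apply/seteqP; split=> w /=.
  move=> <- i _ /=; rewrite inE; case: ifPn => /=; rewrite in_itv/= ?andbT//.
  by rewrite -ltNge.
move=> H; apply/setP => i; rewrite inE.
have := H i; rewrite /= inE => /(_ isT).
by case: ifPn => /= _; rewrite in_itv/= ?andbT// ltNge => /negbTE.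
Qed.

Let measurable_itvJ (p : R) (J : {set 'I_n}) i :
  measurable (if i \in J then `]-oo, p]%classic else `]p, +oo[%classic : set R).
Proof. by case: ifP. Qed.

Let measurable_E p J : measurable (E p J).
Proof.
rewrite EE; apply: fin_bigcap_measurable => // i _.
by rewrite -[X in measurable X]setTI; exact: measurable_funPT.
Qed.

Let probability_E p J : (0 <= p <= 1)%R ->
  P (E p J) = (p ^+ #|J| * (1 - p) ^+ (n - #|J|))%:E.
Proof.
move=> p01; rewrite EE U_indep//.
have -> : (n - #|J| = #|~: J|)%N by rewrite [RHS]cardsCs finset.setCK card_ord.
rewrite -[in (p ^+ _)%R]prodr_const -[in ((1 - p) ^+ _)%R]prodr_const.
rewrite (_ : _ * _ = \prod_i (if i \in J then p else 1 - p))%R; last first.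
  rewrite [RHS](bigID (mem J))/=; congr (_ * _)%R.
    by apply: eq_bigr => i ->.
  rewrite (eq_bigl (fun i => i \notin J)); last by move=> i; rewrite inE.
  by apply: eq_bigr => i /negbTE ->.
rewrite -prodEFin (eq_bigl xpredT); last by move=> i; rewrite inE.
apply: eq_bigr => i _; case: ifPn => _.
  exact: probability_uniform_le.
exact: probability_uniform_gt.
Qed.

Local Open Scope ereal_scope.

(** Exactly one of the finitely many events [E p J] contains [w], so any function of the count is a
    simple function. *)
Lemma sample_count_decomp p (h : nat -> R) w :
  (h (sample_count (fun i => U i w) p))%:E =
  \sum_(J : {set 'I_n}) (h #|J|)%:E * (\1_(E p J) w)%:E.
Proof.
rewrite (bigD1 [set i | (U i w <= p)%R]%SET)//= big1 ?adde0.
  by rewrite indicE mem_set ?mule1.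
move=> J /eqP nJ; rewrite indicE memNset ?mule0//.
by rewrite /E/= => /esym.
Qed.

Lemma integral_sample_count p (h : nat -> R) : (0 <= p <= 1)%R ->
  (forall k, 0 <= h k)%R ->
  \int[P]_w (h (sample_count (fun i => U i w) p))%:E = (binomial_mean p n h)%:E.
Proof.
move=> p01 h0; under eq_integral do rewrite sample_count_decomp.
rewrite ge0_integral_sum//; last 2 first.
- move=> J; apply: emeasurable_funM => //.
  by apply/measurable_EFinP; exact: measurable_indic.
- by move=> J x _; rewrite mule_ge0// lee_fin.
rewrite /binomial_mean -sumEFin; apply: eq_bigr => J _.
rewrite ge0_integralZl//; last 2 first.
- by apply/measurable_EFinP; exact: measurable_indic.
- by rewrite lee_fin.
rewrite integral_indic// setIT [X in _ * X](probability_E J p01) -EFinM.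
by rewrite mulrC.
Qed.

Lemma measurable_sample_count p (h : nat -> R) :
  measurable_fun setT (fun w => (h (sample_count (fun i => U i w) p))%:E).
Proof.
rewrite (_ : (fun w => _) = fun w => \sum_(J : {set 'I_n}) (h #|J|)%:E * (\1_(E p J) w)%:E).
  apply: emeasurable_sum => J; apply: emeasurable_funM => //.
  by apply/measurable_EFinP; exact: measurable_indic.
by apply/funext => w; exact: sample_count_decomp.
Qed.

Lemma integral_sum_sample_count (I : finType) (p : I -> R) (h : I -> nat -> R) :
  (forall i, 0 <= p i <= 1)%R -> (forall i k, 0 <= h i k)%R ->
  \int[P]_w (\sum_i h i (sample_count (fun j => U j w) (p i)))%:E =
  (\sum_i binomial_mean (p i) n (h i))%:E.
Proof.
move=> p01 h0; under eq_integral do rewrite -sumEFin.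
rewrite ge0_integral_sum//; last 2 first.
- by move=> i; exact: measurable_sample_count.
- by move=> i x _; rewrite lee_fin.
by rewrite -sumEFin; apply: eq_bigr => i _; exact: integral_sample_count.
Qed.

(* [f] need not be measurable: it is dominated by adding [+oo] on the null event
   that some [U i] leaves [[0, 1]]. *)
Lemma integral_le_sample_count (f : T -> \bar R) (I : finType) (p : I -> R) (h : I -> nat -> R) :
  (forall i, 0 <= p i <= 1)%R -> (forall i k, 0 <= h i k)%R ->
  (forall w, 0 <= f w) ->
  (forall w, (forall i, 0 <= U i w <= 1)%R ->
     f w <= (\sum_i h i (sample_count (fun j => U j w) (p i)))%:E) ->
  \int[P]_w f w <= (\sum_i binomial_mean (p i) n (h i))%:E.
Proof.
move=> p01 h0 f0 fle.
pose B := \bigcup_(i in [set: 'I_n]) (U i @^-1` (~` `[0%R, 1%R]))%classic.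
have mi i : measurable (U i @^-1` (~` `[0%R, 1%R]))%classic.
  by rewrite -[X in measurable X]setTI; apply: measurable_funPT => //; exact: measurableC.
have mB : measurable B by apply: fin_bigcup_measurable => // i _; exact: mi.
have PB : P B = 0.
  apply/eqP; rewrite -measure_le0.
  apply: le_trans (@measure_cover_le _ _ _ P _ (index_enum 'I_n) _ _ mB mi _) _.
    by move=> w [i _ Bi]; exists i => //; rewrite mem_index_enum.
  by rewrite big1// => i _; exact: probability_uniform_out.
pose g w := (\sum_i h i (sample_count (fun j => U j w) (p i)))%:E.
apply: (@le_trans _ _ (\int[P]_w (g w + +oo * (\1_B w)%:E))).
  apply: le_integral_nonmeasurable => // w.
  have [Bw|nBw] := pselect (B w).
    by rewrite indicE mem_set// mule1 addey ?leey.
  rewrite indicE memNset// mule0 adde0; apply: fle => i.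
  by apply/negPn/negP => H; apply: nBw; exists i => //=; rewrite in_itv/=; exact/negP.
rewrite ge0_integralD//; last 3 first.
- by move=> w _; rewrite lee_fin; exact: sumr_ge0.
- rewrite (_ : g = fun w => \sum_i (h i (sample_count (fun j => U j w) (p i)))%:E).
    by apply: emeasurable_sum => i; exact: measurable_sample_count.
  by apply/funext => w; rewrite /g -sumEFin.
- by apply: emeasurable_funM => //; apply/measurable_EFinP; exact: measurable_indic.
rewrite integral_sum_sample_count// ge0_integralZl//; last first.
  by apply/measurable_EFinP; exact: measurable_indic.
by rewrite integral_indic// setIT [X in _ * X]PB mule0 adde0.
Qed.

End UniformSample.

(** * Ranks of the starting positions *)

Section Ranks.
Context {R : realType} {n : nat}.
Variable u : 'I_n -> R.

(* Ties are broken by index, so that ranks form a permutation. *)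
Let before (i : 'I_n) : {set 'I_n} :=
  [set l | (u l < u i) || (u l == u i) && (l < i)%N]%SET.

Let card_before_lt i : (#|before i| < n)%N.
Proof.
rewrite -[X in (_ < X)%N]card_ord -cardsT; apply: proper_card.
apply/properP; split; first exact: finset.subsetT.
by exists i; rewrite ?inE// ltxx eqxx ltnn.
Qed.

Definition sample_rank i : 'I_n := Ordinal (card_before_lt i).

Lemma sample_rank_inj : injective sample_rank.
Proof.
have before_lt i j : (u i < u j) || (u i == u j) && (i < j)%N ->
    (sample_rank i < sample_rank j)%N.
  move=> ij; apply: proper_card; apply/properP; split; last first.
    by exists i; rewrite ?inE// ltxx eqxx ltnn.
  apply/fintype.subsetP => l; rewrite !inE.
  case/orP: ij => [ij|/andP[/eqP -> ij]].
    by case/orP => [li|/andP[/eqP -> _]]; rewrite ?ij// (lt_trans li ij).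
  case/orP => [->//|/andP[-> li]]; by rewrite (ltn_trans li ij) orbT.
move=> i j ij; apply/eqP/negPn/negP => nij.
have : ((u i < u j) || (u i == u j) && (i < j)%N) ||
       ((u j < u i) || (u j == u i) && (j < i)%N).
  case: (ltgtP (u i) (u j)) => //= _.
  by rewrite -neq_ltn.
by case/orP => /before_lt; rewrite ij ltnn.
Qed.

(** This lemma and the next one turn the position of the sensor of a given rank into a condition on
    a count, whose law is known. *)
Lemma sample_count_le_rank i p : p < u i -> (sample_count u p <= sample_rank i)%N.
Proof.
move=> pu; apply: subset_leq_card; apply/fintype.subsetP => l; rewrite !inE => lp.
by rewrite (le_lt_trans lp pu).
Qed.

Lemma sample_rank_lt_count i p : u i <= p -> (sample_rank i < sample_count u p)%N.
Proof.
move=> up; apply: proper_card; apply/properP; split; last first.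
  by exists i; rewrite ?inE// ltxx eqxx ltnn.
apply/fintype.subsetP => l; rewrite !inE.
by case/orP => [/ltW lu|/andP[/eqP -> _]//]; exact: le_trans lu up.
Qed.

End Ranks.

(** * The covering by equally spaced anchors *)

Section AnchorCost.
Context {R : realType} {n : nat}.
Implicit Types (u : 'I_n -> R) (r : R).

(** Midpoint of the [k]-th of the [n] cells of length [1/n] of [[0, 1]], counted from [0]. *)
Definition anchor (k : nat) : R := (k%:R + 2^-1) / n%:R.

Lemma min_displacement_cost_ge0 a r u : 0 <= min_displacement_cost a r u.
Proof.
have [[c Ec]|/set0P/negP/negPn/eqP E0] :=
    pselect ([set displacement_cost a u b | b in attains_coverage r] !=set0).
  apply: lb_le_inf; first by exists c.
  by move=> _ [b _ <-]; apply: sumr_ge0 => i _; exact: exprn_ge0.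
(* Without any covering the infimum takes its default value [0]. *)
by rewrite /min_displacement_cost E0 inf0.
Qed.

Lemma min_displacement_cost_le a r u b :
  attains_coverage r b -> min_displacement_cost a r u <= displacement_cost a u b.
Proof.
move=> cov; apply: ge_inf; last by exists b.
by exists 0 => _ [c _ <-]; apply: sumr_ge0 => i _; exact: exprn_ge0.
Qed.

Lemma anchor_coverage r u : (0 < n)%N -> (2 * n%:R)^-1 <= r ->
  attains_coverage r (fun i => anchor (sample_rank u i)).
Proof.
move=> n0 rn x x01; have /andP[x0 x1] : 0 <= x <= 1 by move: x01; rewrite /= in_itv.
have n0R : 0 < n%:R :> R by rewrite ltr0n.
have [k kn /andP[kx xk]] : exists2 k, (k < n)%N & k%:R <= x * n%:R <= k%:R + 1.
  have xn0 : 0 <= x * n%:R by rewrite mulr_ge0// ltW.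
  have /andP[tl tr] := truncn_itv xn0.
  have [lt|ge] := ltnP (Num.truncn (x * n%:R)) n.
    by exists (Num.truncn (x * n%:R)) => //; rewrite tl natr1 ltW.
  (* At [x = 1] the truncation is [n], and the last cell is used instead. *)
  have : n%:R <= x * n%:R by apply: le_trans tl; rewrite ler_nat.
  move=> nx; exists n.-1; first by lia.
  have : n.-1%:R + 1 = n%:R :> R by rewrite natr1 prednK.
  have : x * n%:R <= n%:R by rewrite ler_piMl// ltW.
  by move: (n.-1%:R : R) => z xn1 zn; apply/andP; split; lra.
(* Some sensor has rank [k], since ranks form a permutation. *)
have [g _ gK] : bijective (@sample_rank _ _ u) by apply: injF_bij; exact: sample_rank_inj.
exists (g (Ordinal kn)) => //; rewrite gK /= in_itv/= -ler_distlC distrC.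
have -> : x - anchor k = (x * n%:R - k%:R - 2^-1) / n%:R.
  by rewrite /anchor; field; rewrite gt_eqF.
apply: le_trans rn; rewrite normrM invfM normfV [`|n%:R|]gtr0_norm//.
rewrite ler_pM2r ?invr_gt0// ler_norml; lra.
Qed.

End AnchorCost.

(** * Exponential bounds on the displacement to the anchor *)

Section AnchorDisplacement.
Context {R : realType} {n : nat}.
Implicit Types (u : 'I_n -> R).
Variables (a : nat).
Hypotheses (a0 : (0 < a)%N) (n0 : (0 < n)%N).
Let h : R := (Num.sqrt n%:R)^-1.

(** The levels lie to the left of the anchor for [b = true] and to its right for [b = false]. *)
Definition anchor_level (k l : 'I_n) (b : bool) : R :=
  @anchor R n k + (-1) ^+ b * (l%:R * h).

(* Levels outside [[0, 1]] never occur in [anchor_displacement_le]; they get the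
   dummy parameter [0] and cost [0]. *)
Definition level_point k l b : R :=
  if 0 <= anchor_level k l b <= 1 then anchor_level k l b else 0.

(* [expR (- l%:R) * expR (...)] is the Chernoff majorant of the indicator that the
   sensor of rank [k] starts beyond the level. *)
Definition level_cost k l b (N : nat) : R :=
  if 0 <= anchor_level k l b <= 1 then
    h ^+ a * (l.+1%:R ^+ a * expR (- l%:R)) *
      expR ((- (-1) ^+ b * h) * (N%:R - n%:R * anchor_level k l b))
  else 0.

Let sqrtn_gt0 : 0 < Num.sqrt n%:R :> R. Proof. by rewrite sqrtr_gt0 ltr0n. Qed.
Let h_gt0 : 0 < h. Proof. by rewrite invr_gt0. Qed.
Let nhh : n%:R * h * h = 1.
Proof.
rewrite /h; move: sqrtn_gt0 (sqr_sqrtr (ler0n R n)); move: (Num.sqrt _) => s s0 <-.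
by field; rewrite gt_eqF.
Qed.

Lemma level_point_itv k l b : 0 <= level_point k l b <= 1.
Proof. by rewrite /level_point; case: ifPn => // _; rewrite lexx ler01. Qed.

Lemma level_cost_ge0 k l b N : 0 <= level_cost k l b N.
Proof.
rewrite /level_cost; case: ifPn => // _.
by rewrite !mulr_ge0 ?expR_ge0// ?exprn_ge0// ltW.
Qed.

(** If [l + 1] is the least [m] with [|D| <= m h], the sensor starts beyond level [l] on the side
    given by the sign of [D], and that single term already dominates [|D|^a]. Levels [l < n] suffice
    because [|D| <= 1 <= n h]. *)
Lemma anchor_displacement_le u i (k := sample_rank u i) :
  0 <= u i <= 1 ->
  `|u i - @anchor R n k| ^+ a <=
  \sum_(l < n) \sum_(b : bool) level_cost k l b (sample_count u (level_point k l b)).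
Proof.
move=> /andP[u0 u1]; set t := anchor k; set D := u i - t.
have n0R : 0 < n%:R :> R by rewrite ltr0n.
have nt : n%:R * t = k%:R + 2^-1 by rewrite /t /anchor mulrC divfK// gt_eqF.
have kn : k%:R + 1 <= n%:R :> R by rewrite natr1 ler_nat.
have k0 : 0 <= k%:R :> R by [].
have t0 : 0 <= t by rewrite -(ler_pM2l n0R) nt mulr0; lra.
have t1 : t <= 1 by rewrite -(ler_pM2l n0R) nt mulr1; lra.
have D1 : `|D| <= n%:R * h.
  apply: (@le_trans _ _ 1); first by rewrite /D ler_norml; lra.
  have h1 : h <= 1.
    by rewrite /h invf_le1// -{1}sqrtr1 ler_wsqrtr// ler1n.
  by rewrite -[leLHS]nhh ler_piMr// mulr_ge0// ltW.
have sum0 : 0 <= \sum_(l < n) \sum_(b : bool)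
    level_cost k l b (sample_count u (level_point k l b)).
  by apply: sumr_ge0 => l _; apply: sumr_ge0 => b _; exact: level_cost_ge0.
have exm : exists m, `|D| <= m%:R * h by exists n.
case: (ex_minnP exm) => -[|l] lD lmin.
  have -> : D = 0 by apply/normr0_eq0/eqP; rewrite eq_le normr_ge0 andbT -(mul0r h).
  (* A zero displacement costs nothing because [0 < a]. *)
  by rewrite normr0 expr0n gtn_eqF.
have ln : (l < n)%N by exact: lmin.
have Dl : l%:R * h < `|D|.
  by rewrite ltNge; apply/negP => /lmin; rewrite ltnn.
pose b := D < 0.
have lb0 : 0 <= l%:R * h by rewrite mulr_ge0// ltW.
apply: (@le_trans _ _ (level_cost k (Ordinal ln) b
    (sample_count u (level_point k (Ordinal ln) b)))); last first.
  rewrite (bigD1 (Ordinal ln))//= (bigD1 b)//= -addrA lerDl addr_ge0//.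
    by apply: sumr_ge0 => b' _; exact: level_cost_ge0.
  by apply: sumr_ge0 => l' _; apply: sumr_ge0 => b' _; exact: level_cost_ge0.
have lvl : 0 <= anchor_level k (Ordinal ln) b <= 1.
  rewrite /anchor_level /= -/t /b; move: Dl; case: (ltP D 0) => D0.
    by rewrite ltr0_norm// expr1 => Dl; rewrite /D in D0 Dl; apply/andP; split; lra.
  by rewrite ger0_norm// expr0 => Dl; rewrite /D in D0 Dl; apply/andP; split; lra.
rewrite /level_cost /level_point lvl -[_ * expR _]mulrA.
apply: (@le_trans _ _ (h ^+ a * l.+1%:R ^+ a)).
  by rewrite -exprMn mulrC; apply: lerXn2r; rewrite ?nnegrE// mulr_ge0// ltW.
rewrite ler_wpM2l ?(exprn_ge0 _ (ltW h_gt0))// -[leRHS]mulrA ler_peMr ?exprn_ge0// -expRD.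
rewrite -[leLHS]expR0 ler_expR /= /anchor_level -/t /=.
(* As [n h^2 = 1], the offset [l h] of the level adds [l] to the exponent and cancels
   [expR (- l%:R)]. What remains is [h] times the gap between the count and [k + 1/2], which is
   nonnegative by the rank inequality on either side. *)
have nhl : n%:R * (l%:R * h) * h = l%:R by rewrite -[RHS]mulr1 -[X in _ = _ * X]nhh; ring.
move: Dl; rewrite /b; case: (ltP D 0) => D0 Dl /=.
  rewrite expr1.
  have : (k < sample_count u (t + -1 * (l%:R * h)))%N.
    apply: sample_rank_lt_count; move: Dl; rewrite ltr0_norm// /D; lra.
  rewrite -(ler_nat R) -natr1 => c.
  set N := (sample_count _ _)%:R in c *.
  have : 0 <= h * (N - (k%:R + 2^-1)) by rewrite mulr_ge0 ?(ltW h_gt0)//; lra.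
  rewrite -nt => hN; lra.
rewrite expr0.
have : (sample_count u (t + 1 * (l%:R * h)) <= k)%N.
  apply: sample_count_le_rank; move: Dl; rewrite ger0_norm// /D; lra.
rewrite -(ler_nat R) => c.
set N := (sample_count _ _)%:R in c *.
have : 0 <= h * (k%:R + 2^-1 - N) by rewrite mulr_ge0 ?(ltW h_gt0)//; lra.
rewrite -nt => hN; lra.
Qed.

(** Reindexing the sensors by rank makes the levels independent of [u], so that only the counts are
    random. *)
Lemma min_cost_le_levels r u : (2 * n%:R)^-1 <= r ->
  (forall i, 0 <= u i <= 1) ->
  min_displacement_cost a r u <=
  \sum_(x : 'I_n * 'I_n * bool)
    level_cost x.1.1 x.1.2 x.2 (sample_count u (level_point x.1.1 x.1.2 x.2)).
Proof.
move=> rn u01; apply: le_trans (min_displacement_cost_le _ _ (anchor_coverage u n0 rn)) _.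
rewrite /displacement_cost.
apply: le_trans (ler_sum _ (fun i _ => anchor_displacement_le (u01 i))) _.
pose F (k : 'I_n) := \sum_(l < n) \sum_(b : bool)
  level_cost k l b (sample_count u (level_point k l b)).
rewrite [leRHS](_ : _ = \sum_k F k); last by rewrite /F pair_big pair_big.
by rewrite [leRHS](reindex_inj (@sample_rank_inj _ _ u)).
Qed.

(** The exponential moment bound applies with parameter [h] or [- h], admissible since [n >= 4]
    gives [h <= 1/2], and its exponent [2 h^2 n] equals [2]. *)
Lemma binomial_mean_level_cost k l b : (4 <= n)%N ->
  binomial_mean (level_point k l b) n (level_cost k l b) <=
  h ^+ a * (l.+1%:R ^+ a * expR (- l%:R)) * expR 2.
Proof.
move=> n4; have hh : h <= 2^-1.
  rewrite lef_pV2 ?posrE//.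
  rewrite (_ : 2 = Num.sqrt (2 ^+ 2)); last by rewrite sqrtr_sqr ger0_norm.
  by rewrite ler_wsqrtr// -natrX ler_nat.
have w0 : 0 <= h ^+ a * (l.+1%:R ^+ a * expR (- l%:R)).
  by rewrite !mulr_ge0 ?expR_ge0// ?exprn_ge0// ltW.
have [lvl|nlvl] := boolP (0 <= anchor_level k l b <= 1); last first.
  rewrite (@eq_binomial_mean _ _ _ _ (fun=> 0)); last first.
    by move=> N; rewrite /level_cost (negbTE nlvl).
  by rewrite binomial_mean_cst mulr_ge0 ?expR_ge0.
rewrite (@eq_binomial_mean _ _ _ _ (fun N : nat =>
    h ^+ a * (l.+1%:R ^+ a * expR (- l%:R)) *
      expR ((- (-1) ^+ b * h) * (N%:R - n%:R * anchor_level k l b)))); last first.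
  by move=> N; rewrite /level_cost lvl.
rewrite binomial_meanZ ler_wpM2l// /level_point lvl.
apply: le_trans (binomial_mgf_le _ lvl _) _.
  by rewrite normrM normrN normrX normrN1 expr1n mul1r gtr0_norm.
rewrite ler_expR -mulrA exprMn sqrrN -exprM mulnC exprM sqrrN !expr1n mul1r.
by rewrite ler_piMr// mulrC expr2 mulrA nhh.
Qed.

End AnchorDisplacement.

(** * The upper bound on the expectation *)

Lemma sum_poly_expRN_bounded (R : realType) (a : nat) : (0 < a)%N ->
  exists2 C : R, 0 < C & forall m, \sum_(l < m) (l.+1%:R ^+ a * expR (- l%:R)) <= C.
Proof.
case: a => // a _.
(* Half of the decay absorbs the power, by [y^(a+1) <= (a+1)! e^y] at [y = (l + 1) / 2]; the other
   half leaves a geometric series of ratio [q]. *)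
pose q : R := expR (- 2^-1).
have q1 : q < 1 by rewrite /q -[ltRHS]expR0 ltr_expR; lra.
have q0 : 0 < q by exact: expR_gt0.
pose K : R := expR 1 * 2 ^+ a.+1 * a.+1`!%:R.
have K0 : 0 < K by rewrite !mulr_gt0 ?expR_gt0 ?exprn_gt0// ltr0n fact_gt0.
exists (K / (1 - q)); first by rewrite divr_gt0// subr_gt0.
move=> m; apply: (@le_trans _ _ (\sum_(l < m) K * q ^+ l)).
  apply: ler_sum => l _; pose y : R := l.+1%:R / 2.
  have y0 : 0 <= y by rewrite divr_ge0.
  have := expR_ge1Dxn a y0 => e.
  have {}e : y ^+ a.+1 <= a.+1`!%:R * expR y.
    rewrite mulrC -ler_pdivrMr; last by rewrite ltr0n fact_gt0.
    by apply: le_trans e; rewrite lerDr.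
  have -> : l.+1%:R = 2 * y :> R by rewrite /y; field.
  rewrite exprMn.
  apply: (@le_trans _ _ (2 ^+ a.+1 * (a.+1`!%:R * expR y) * expR (- l%:R))).
    by rewrite ler_wpM2r ?expR_ge0// ler_wpM2l// exprn_ge0.
  have -> : 2 ^+ a.+1 * (a.+1`!%:R * expR y) * expR (- l%:R) =
      2 ^+ a.+1 * a.+1`!%:R * (expR (y - l%:R)) by rewrite expRD; ring.
  have -> : K * q ^+ l = 2 ^+ a.+1 * a.+1`!%:R * (expR (1 + - 2^-1 * l%:R)).
    by rewrite expRD expRM_natr /K /q; ring.
  rewrite ler_wpM2l ?mulr_ge0 ?exprn_ge0// ler_expR /y -natr1.
  by lra.
rewrite -mulr_sumr ler_pM2l// -[leRHS]mul1r ler_pdivlMr ?subr_gt0// mulrC.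
have := subrX1 q m => e.
have : 0 <= q ^+ m by rewrite exprn_ge0// ltW.
by lra.
Qed.

(** The factor [n] counts the ranks, [2] the sides and [expR 2] the exponential moment. The constant
    is chosen before the probability space, [n] and [r]. *)
Lemma expected_min_cost_upper (R : realType) (a : nat) : (0 < a)%N ->
  exists2 C : R, 0 < C &
  forall (d : measure_display) (T : measurableType d) (P : probability T R)
    (n : nat) (U : 'I_n -> {RV P >-> R}) (r : R),
    (forall i, uniform01 (U i)) -> mutually_independent U ->
    (4 <= n)%N -> (2 * n%:R)^-1 <= r ->
    (expected_min_cost a r U <= (C * (n%:R * (Num.sqrt n%:R)^-1 ^+ a))%:E)%E.
Proof.
move=> a0; have [C C0 Csum] := sum_poly_expRN_bounded R a0.
exists (2 * expR 2 * C); first by rewrite !mulr_gt0 ?expR_gt0.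
move=> d T P n U r Uu Ui n4 rn.
have n0 : (0 < n)%N by lia.
rewrite /expected_min_cost unlock.
apply: le_trans (@integral_le_sample_count _ _ _ _ _ _ Uu Ui _ _
   (fun x : 'I_n * 'I_n * bool => level_point x.1.1 x.1.2 x.2)
   (fun x => level_cost a x.1.1 x.1.2 x.2) _ _ _ _) _.
- by move=> x; exact: level_point_itv.
- by move=> x k; exact: level_cost_ge0.
- by move=> w; rewrite lee_fin min_displacement_cost_ge0.
- by move=> w w01; rewrite lee_fin; exact: min_cost_le_levels.
rewrite lee_fin.
set h := (Num.sqrt n%:R)^-1.
apply: le_trans (ler_sum _ (fun x _ => binomial_mean_level_cost a n0 x.1.1 x.1.2 x.2 n4)) _.
rewrite -/h.
rewrite -(pair_big xpredT xpredT (fun (x : 'I_n * 'I_n) (b : bool) =>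
   h ^+ a * (x.2.+1%:R ^+ a * expR (- x.2%:R)) * expR 2))/=.
rewrite -(pair_big xpredT xpredT (fun (k l : 'I_n) => \sum_(b : bool)
   h ^+ a * (l.+1%:R ^+ a * expR (- l%:R)) * expR 2))/=.
rewrite [leLHS](_ : _ =
  n%:R * (2 * expR 2 * h ^+ a * \sum_(l < n) l.+1%:R ^+ a * expR (- l%:R))); last first.
  rewrite sumr_const card_ord -[LHS]mulr_natl; congr (_ * _).
  rewrite mulr_sumr; apply: eq_bigr => l _.
  by rewrite sumr_const card_bool -[LHS]mulr_natl; ring.
have -> : 2 * expR 2 * C * (n%:R * h ^+ a) = n%:R * (2 * expR 2 * h ^+ a * C) by ring.
rewrite ler_wpM2l// ler_wpM2l ?mulr_ge0 ?expR_ge0//.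
by rewrite exprn_ge0// invr_ge0 sqrtr_ge0.
Qed.

(** * Lower bounds on the cost of an arbitrary covering *)

Section LowerBound.
Context {R : realType}.
Implicit Types (r p x b u : R) (n a : nat).

(** Only sensors with [b i - r <= x] meet [[0, x]], and each covers a length of at most [2 r]. *)
Lemma coverage_count n r (b : 'I_n -> R) x : attains_coverage r b -> 0 <= r ->
  x <= 1 -> x <= 2 * r * #|[set i | b i <= x + r]%SET|%:R.
Proof.
move=> cov r0 x1; have [x0|x0] := leP x 0.
  by apply: le_trans x0 _; rewrite !mulr_ge0.
have -> : 2 * r * #|[set i | b i <= x + r]%SET|%:R =
    \sum_(i <- enum [set i | b i <= x + r]%SET) (2 * r).
  by rewrite big_enum sumr_const mulr_natr.
rewrite -lee_fin -sumEFin.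
have itvE (c e : R) : c <= e -> lebesgue_measure `[c, e]%classic = (e - c)%:E.
  rewrite lebesgue_measure_itv/= lte_fin.
  by case: ltrgtP => // ->; rewrite subrr.
have {1}-> : x = x - 0 by rewrite subr0.
rewrite -itvE ?(ltW x0)//.
rewrite (eq_bigr (fun i => lebesgue_measure `[b i - r, b i + r]%classic)); last first.
  by move=> i _; rewrite itvE; [congr (_%:E); ring|lra].
apply: (@measure_cover_le _ _ _ (@lebesgue_measure R) _ _
  (fun i => `[b i - r, b i + r]%classic) `[0, x]%classic) => // y /=.
rewrite in_itv/= => /andP[y0 yx].
have [|i _ /= yi] := cov y; first by rewrite /= in_itv/= y0 (le_trans yx).
by exists i => //; rewrite mem_enum inE; move: yi; rewrite in_itv/= => /andP[]; lra.
Qed.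

(** The intervals of length [dl] ending at the levels do not overlap, so each crossed level accounts
    for its own share of the path from [u] to [b]. *)
Let crossed p0 dl b u (j : nat) : bool :=
  (b + dl <= p0 + j%:R * dl) && (p0 + j%:R * dl < u).

(* Clamping to [[b, u]] turns each counted level into an increment [dl], and the
   increments telescope. *)
Lemma crossed_levels_le p0 dl b u J : 0 < dl ->
  (\sum_(j < J) crossed p0 dl b u j)%:R * dl
  <= `|u - b|.
Proof.
move=> dl0; have [bu|ub] := leP b u; last first.
  rewrite big1 ?mul0r// => j _; apply/eqP; rewrite eqb0 /crossed; apply/negP => /andP[]; lra.
rewrite ger0_norm ?subr_ge0//.
pose g x := Num.min u (Num.max b x).
have gb x : b <= g x <= u.
  rewrite /g; case: (leP b x) => bx; case: (leP u _) => ux; apply/andP; split; lra.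
apply: (@le_trans _ _ (g (p0 + J%:R * dl - dl) - g (p0 - dl))); last first.
  by have := gb (p0 + J%:R * dl - dl); have := gb (p0 - dl); lra.
elim: J => [|J IH].
  by rewrite big_ord0 !mulr0n !mul0r addr0 subrr.
rewrite big_ord_recr/= natrD mulrDl.
suff : (crossed p0 dl b u J)%:R * dl <=
    g (p0 + J.+1%:R * dl - dl) - g (p0 + J%:R * dl - dl) by lra.
rewrite -natr1; set y := p0 + J%:R * dl.
have -> : p0 + (J%:R + 1) * dl - dl = y by rewrite /y; ring.
rewrite /crossed -/y; case: andP => [[by_ yu]|_] /=; rewrite ?mulr1n ?mulr0n ?mul1r ?mul0r /g.
  rewrite (max_r (_ : b <= y)); last by lra.
  rewrite (max_r (_ : b <= y - dl)); last by lra.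
  by rewrite !min_r; lra.
rewrite subr_ge0 le_min !ge_min; apply/andP; split; apply/orP; [by left|right].
by rewrite ge_max !le_max; apply/andP; split; apply/orP; [by left|right; lra].
Qed.

(** A natural number [c] satisfies [c <= c^a]. A bound linear in the count lets the sums over
    sensors and levels be exchanged. *)
Lemma crossed_levels_pow_le a p0 dl b u J : (0 < a)%N -> 0 < dl ->
  dl ^+ a * (\sum_(j < J) crossed p0 dl b u j)%:R
  <= `|u - b| ^+ a.
Proof.
move=> a0 dl0; have := @crossed_levels_le p0 dl b u J dl0.
set c := (\sum_(j < J) _)%N; case: (posnP c) => [->|c0] cu.
  by rewrite mulr0 exprn_ge0.
apply: (@le_trans _ _ ((c%:R * dl) ^+ a)); last first.
  by apply: lerXn2r => //; rewrite nnegrE mulr_ge0// ltW.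
rewrite exprMn mulrC ler_wpM2r ?exprn_ge0 ?(ltW dl0)//.
by rewrite ler_eXnr// ler1n.
Qed.

(** At each level the crossing sensors are those of [A] outside [B], at least [#|A| - #|B|] of them;
    coverage bounds [#|A|] from below, and [#|B|] is the initial count. *)
Lemma displacement_cost_ge n a r (u b : 'I_n -> R) p0 dl J :
  (0 < a)%N -> 0 < r -> 0 < dl -> attains_coverage r b ->
  (forall j : 'I_J, p0 + j%:R * dl - dl - r <= 1) ->
  \sum_(j < J) dl ^+ a * Num.max 0
    ((p0 + j%:R * dl - dl - r) / (2 * r) - (sample_count u (p0 + j%:R * dl))%:R)
  <= displacement_cost a u b.
Proof.
move=> a0 r0 dl0 cov pj1; rewrite /displacement_cost.
apply: (@le_trans _ _ (\sum_(i < n) dl ^+ a * (\sum_(j < J)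
   crossed p0 dl (b i) (u i) j)%:R)); last first.
  by apply: ler_sum => i _; exact: crossed_levels_pow_le.
rewrite -!mulr_sumr ler_wpM2l ?exprn_ge0 ?(ltW dl0)//.
under [leRHS]eq_bigr do rewrite natr_sum.
rewrite exchange_big/=; apply: ler_sum => j _.
set y := p0 + j%:R * dl.
rewrite ge_max; apply/andP; split; first by apply: sumr_ge0.
pose A := [set i | b i <= y - dl]%SET; pose B := [set i | u i <= y]%SET.
have -> : \sum_(i < n) (crossed p0 dl (b i) (u i) j)%:R = #|(A :\: B)%SET|%:R :> R.
  rewrite -natr_sum; congr _%:R; rewrite -sum1_card [RHS]big_mkcond/=.
  by apply: eq_bigr => i _; rewrite /crossed -/y !inE andbC -ltNge lerBrDr; case: ifP.
have cA : (y - dl - r) / (2 * r) <= #|A|%:R.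
  rewrite ler_pdivrMr ?mulr_gt0// mulrC.
  by have := coverage_count cov (ltW r0) (pj1 j); rewrite subrK.
have : (#|A| <= #|A :\: B| + #|B|)%N.
  by rewrite -(cardsID B A) addnC leq_add2l subset_leq_card// finset.subsetIr.
rewrite -(ler_nat R) natrD -/(sample_count u y) => AB.
by rewrite /sample_count -/B; lra.
Qed.

(* Bounds [E |S|] from below by the second and fourth moments of [S]. *)
Lemma sub_quartic_le_norm (s t : R) : 0 < t -> s ^+ 2 / t - s ^+ 4 / t ^+ 3 <= `|s|.
Proof.
move=> t0; pose v := `|s| / t.
have v0 : 0 <= v by rewrite divr_ge0// ltW.
have sE : `|s| = v * t by rewrite /v divfK// gt_eqF.
have s2 : s ^+ 2 = (v * t) ^+ 2 by rewrite -sE real_normK// num_real.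
have -> : s ^+ 4 = (v * t) ^+ 4 by rewrite (exprM s 2 2) s2 -exprM.
rewrite s2 sE.
have -> : (v * t) ^+ 2 / t - (v * t) ^+ 4 / t ^+ 3 = (v ^+ 2 - v ^+ 4) * t.
  by field; rewrite gt_eqF.
rewrite ler_pM2r//; have [v1|v1] := leP v 1.
  have : 0 <= v * (1 - v) by rewrite mulr_ge0// subr_ge0.
  have : 0 <= v ^+ 4 by exact: exprn_ge0.
  by lra.
have v10 : 0 <= v - 1 by lra.
have : 0 <= v ^+ 2 * (v - 1) * (v + 1).
  by rewrite mulr_ge0 ?addr_ge0// mulr_ge0// exprn_ge0.
by lra.
Qed.

(** With [s = k - n p], of mean zero, the positive part is at least [(|s| - s) / 2 - q / 128]. The
    quartic bound at [t = 4 q], a variance of at least [3 n / 16] and a fourth moment of at most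
    [n^2 / 4] give [3 q / 128 - q / 512 - q / 128]. *)
Lemma binomial_mean_deficit_ge n p c (q := Num.sqrt n%:R : R) :
  (4 <= n)%N -> 4^-1 <= p <= 3 / 4 -> n%:R * p - q / 128 <= c ->
  q / 128 <= binomial_mean p n (fun k => Num.max 0 (c - k%:R)).
Proof.
move=> n4 /andP[p1 p2] cp.
have q0 : 0 < q by rewrite sqrtr_gt0 ltr0n; lia.
have q2 : q ^+ 2 = n%:R by rewrite sqr_sqrtr.
have nR : 4 <= n%:R :> R by rewrite (ler_nat R 4).
pose t := 4 * q; have t0 : 0 < t by rewrite mulr_gt0.
pose x := - (n%:R * p).
pose w k : R := (2 * t)^-1 * (k%:R + x) ^+ 2 + ((- (2 * t ^+ 3)^-1) * (k%:R + x) ^+ 4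
   + (- 2^-1 * (k%:R + x) + - (q / 128))).
apply: (@le_trans _ _ (binomial_mean p n w)); last first.
  apply: le_binomial_mean => [|k]; first by lra.
  have := @sub_quartic_le_norm (k%:R + x) t t0.
  have -> : w k = ((k%:R + x) ^+ 2 / t - (k%:R + x) ^+ 4 / t ^+ 3 - (k%:R + x)) / 2 - q / 128.
    by rewrite /w; field; rewrite gt_eqF.
  set z := _ / t - _ => zk; rewrite le_max.
  have [s0|s0] := leP 0 (k%:R + x).
    by rewrite ger0_norm// in zk; apply/orP; left; lra.
  by rewrite ltr0_norm// in zk; apply/orP; right; rewrite /x in zk s0 *; lra.
rewrite /w !binomial_meanD !binomial_meanZ binomial_mean2 binomial_mean4.
rewrite binomial_mean1 binomial_mean_cst.
have -> : n%:R * p + x = 0 by rewrite /x subrr.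
pose v := p * (1 - p).
have v1 : 3 / 16 <= v.
  have : 0 <= (p - 4^-1) * (3 / 4 - p) by rewrite mulr_ge0//; lra.
  by rewrite /v; lra.
have v2 : v <= 4^-1.
  have : 0 <= (p - 2^-1) ^+ 2 by exact: sqr_ge0.
  by rewrite /v; lra.
have m4 : n%:R * v * (1 + 3 * (n%:R - 2) * v) <= n%:R ^+ 2 / 4.
  have : (n%:R - 2) * v <= (n%:R - 2) * 4^-1 by rewrite ler_wpM2l//; lra.
  move=> nv; have : n%:R * v * (1 + 3 * (n%:R - 2) * v) <= n%:R * v * n%:R.
    by rewrite ler_wpM2l ?mulr_ge0//; lra.
  have : n%:R * (v * n%:R) <= n%:R * (4^-1 * n%:R) by rewrite ler_wpM2l// ler_wpM2r.
  by lra.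
have e1 : q * (3 / 128) <= (2 * t)^-1 * (n%:R * v).
  have -> : (2 * t)^-1 * (n%:R * v) = q * (v / 8).
    by rewrite -q2 /t; field; rewrite gt_eqF.
  by rewrite ler_wpM2l ?(ltW q0)//; lra.
have e2 : (2 * t ^+ 3)^-1 * (n%:R * v * (1 + 3 * (n%:R - 2) * v)) <= q / 512.
  have -> : q / 512 = (2 * t ^+ 3)^-1 * (n%:R ^+ 2 / 4).
    by rewrite -q2 /t; field; rewrite gt_eqF.
  by rewrite ler_wpM2l// invr_ge0 mulr_ge0// exprn_ge0// ltW.
rewrite [leRHS](_ : _ = (2 * t)^-1 * (n%:R * v) -
    (2 * t ^+ 3)^-1 * (n%:R * v * (1 + 3 * (n%:R - 2) * v)) - q / 128); first by lra.
by rewrite /v; ring.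
Qed.

Lemma min_displacement_cost_ge n a r (u : 'I_n -> R) p0 dl J :
  (0 < a)%N -> (0 < n)%N -> (2 * n%:R)^-1 <= r -> 0 < dl ->
  (forall j : 'I_J, p0 + j%:R * dl - dl - r <= 1) ->
  \sum_(j < J) dl ^+ a * Num.max 0
    ((p0 + j%:R * dl - dl - r) / (2 * r) - (sample_count u (p0 + j%:R * dl))%:R)
  <= min_displacement_cost a r u.
Proof.
move=> a0 n0 rn dl0 pj1; apply: lb_le_inf.
  (* Some covering must exist, as the infimum of the empty set would be [0]. *)
  by eexists; eexists; first exact: (anchor_coverage u n0 rn).
move=> _ [b cov <-]; apply: displacement_cost_ge => //.
by apply: lt_le_trans rn; rewrite invr_gt0 mulr_gt0// ltr0n.
Qed.

End LowerBound.

(** * The lower bound on the expectation *)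

Lemma expected_min_cost_lower (R : realType) (a : nat)
  (d : measure_display) (T : measurableType d) (P : probability T R)
  (n : nat) (U : 'I_n -> {RV P >-> R}) (e : R) (q := Num.sqrt n%:R : R) :
  (0 < a)%N -> (forall i, uniform01 (U i)) -> mutually_independent U ->
  512 <= q -> 0 < e -> n%:R ^+ 2 * e <= q / 1024 ->
  ((256^-1 ^+ a / 4 * (n%:R * q^-1 ^+ a))%:E <=
   expected_min_cost a (1 / (2 * n%:R) + e / 2) U)%E.
Proof.
move=> a0 Uu Ui q512 e0 ne.
have q0 : 0 < q by lra.
have q2 : q ^+ 2 = n%:R by rewrite sqr_sqrtr.
have n512 : 512 * 512 <= n%:R :> R.
  have : 0 <= (q - 512) * (q + 512) by apply: mulr_ge0; lra.
  by rewrite -q2; lra.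
have n0 : (0 < n)%N by rewrite -(ltr0n R); lra.
have n4 : (4 <= n)%N by rewrite -(ler_nat R); lra.
have n0R : 0 < n%:R :> R by rewrite ltr0n.
have nee : n%:R * e <= n%:R ^+ 2 * e.
  by rewrite ler_wpM2r ?(ltW e0)// ler_eXnr//; lra.
have ne0 : 0 < n%:R * e by rewrite mulr_gt0.
set r := 1 / (2 * n%:R) + e / 2.
have rn : (2 * n%:R)^-1 <= r by rewrite /r mul1r lerDl; lra.
have r0 : 0 < r by apply: lt_le_trans rn; rewrite invr_gt0 mulr_gt0.
pose dl : R := q^-1 / 256.
have qi0 : 0 < q^-1 by rewrite invr_gt0.
have dl0 : 0 < dl by rewrite /dl; lra.
have qq : q * q^-1 = 1 by rewrite divff// gt_eqF.
have dl1 : dl <= 4^-1.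
  have : q^-1 <= 1 by rewrite invf_le1//; lra.
  by rewrite /dl; lra.
(* As many levels of spacing [dl] as fit between [1/4] and [3/4]. *)
pose J := Num.truncn (2 * dl)^-1.
have dli0 : 0 < (2 * dl)^-1 by rewrite invr_gt0 mulr_gt0.
have dli : (2 * dl)^-1 * dl = 2^-1 by field; rewrite gt_eqF.
have /andP[J1 J2] := truncn_itv (ltW dli0); rewrite -/J in J1 J2.
have Jdl : 4^-1 <= J%:R * dl.
  have : (2 * dl)^-1 * dl <= J.+1%:R * dl by rewrite ler_wpM2r ?ltW.
  by rewrite dli -[J.+1%:R]natr1; lra.
pose p j : R := 4^-1 + j%:R * dl.
have p01 (j : 'I_J) : 4^-1 <= p j <= 3 / 4.
  have jd0 : 0 <= j%:R * dl by rewrite mulr_ge0// ltW.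
  have : j%:R * dl <= (2 * dl)^-1 * dl.
    by rewrite ler_wpM2r ?(ltW dl0)//; apply: le_trans J1; rewrite ler_nat ltnW.
  by rewrite dli /p => ?; apply/andP; split; lra.
pose c j : R := (p j - dl - r) / (2 * r).
(* The losses are [n dl = q / 256], [n r <= 1/2 + q / 2048] and [n^2 e <= q / 1024]; with
   [1/2 <= q / 1024] they total less than [q / 128]. *)
have cp (j : 'I_J) : n%:R * p j - q / 128 <= c j.
  have /andP[pj0 pj1] := p01 j.
  pose y := p j - dl - r.
  have y1 : y <= 1 by rewrite /y; lra.
  have rE : 2 * r = (1 + n%:R * e) / n%:R by rewrite /r; field; rewrite gt_eqF.
  (* Since [2 r n = 1 + n e] and [y <= 1], dividing by [2 r] instead of [1 / n] loses at most
     [n^2 e]. *)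
  have : n%:R * y - n%:R ^+ 2 * e <= y / (2 * r).
    rewrite ler_pdivlMr ?mulr_gt0// rE mulrA ler_pdivrMr//.
    have : 0 <= n%:R ^+ 2 * e * (1 - y).
      by rewrite mulr_ge0 ?subr_ge0// mulr_ge0 ?exprn_ge0// ltW.
    have : 0 <= n%:R ^+ 2 * e * (n%:R * e).
      by rewrite !mulr_ge0// ltW.
    by lra.
  have nr : n%:R * r = (1 + n%:R * e) / 2 by rewrite /r; field; rewrite gt_eqF.
  have nd : n%:R * dl = q / 256.
    by rewrite /dl -q2; field; rewrite gt_eqF.
  have -> : n%:R * y = n%:R * p j - n%:R * dl - n%:R * r by rewrite /y; ring.
  by rewrite nr nd /c -/y; lra.
rewrite /expected_min_cost unlock.
pose hh j (k : nat) : R := dl ^+ a * Num.max 0 (c j - k%:R).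
apply: (@le_trans _ _ (\int[P]_w (\sum_(j < J)
   hh j (sample_count (fun i => U i w) (p j)))%:E)%E); last first.
  apply: le_integral_nonmeasurable => w; rewrite lee_fin.
    by apply: sumr_ge0 => j _; rewrite mulr_ge0 ?exprn_ge0 ?(ltW dl0)// le_max lexx.
  apply: min_displacement_cost_ge => // j.
  by have := p01 j; rewrite /p; lra.
rewrite (integral_sum_sample_count Uu Ui
  (p := fun j : 'I_J => p j) (h := fun j : 'I_J => hh j)); last 2 first.
- by move=> j; have := p01 j; lra.
- by move=> j k; rewrite mulr_ge0 ?exprn_ge0 ?(ltW dl0)// le_max lexx.
rewrite lee_fin; apply: (@le_trans _ _ (\sum_(j < J) dl ^+ a * (q / 128))); last first.
  apply: ler_sum => j _; rewrite binomial_meanZ ler_wpM2l ?exprn_ge0 ?(ltW dl0)//.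
  exact: binomial_mean_deficit_ge.
rewrite sumr_const card_ord -[leRHS]mulr_natr.
have -> : 256^-1 ^+ a / 4 * (n%:R * q^-1 ^+ a) = dl ^+ a * (n%:R / 4).
  by rewrite /dl exprMn; ring.
rewrite -mulrA ler_wpM2l ?exprn_ge0 ?(ltW dl0)//.
(* At least [64 q] levels, each contributing [dl^a q / 128], give [dl^a n / 2]. *)
have Jq : q * 64 <= J%:R.
  have : 4^-1 * (256 * q) <= J%:R * dl * (256 * q) by apply: ler_wpM2r; lra.
  have -> : J%:R * dl * (256 * q) = J%:R by rewrite /dl; field; rewrite gt_eqF.
  by lra.
have : q / 128 * (q * 64) <= q / 128 * J%:R by apply: ler_wpM2l; lra.
by apply: le_trans; rewrite -q2; lra.
Qed.

(** * Real powers as powers of the square root, and the two-sided estimate *)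

Lemma powR_sqrt_expr (R : realType) (x : R) (k : nat) : 0 < x ->
  x `^ (k%:R / 2) = Num.sqrt x ^+ k.
Proof.
move=> x0; rewrite mulrC powRrM powR12_sqrt ?(ltW x0)//.
by rewrite powR_mulrn// sqrtr_ge0.
Qed.

Lemma inv_powR_half_sub1 (R : realType) (a : nat) (x : R) : 0 < x ->
  1 / x `^ (a%:R / 2 - 1) = x * (Num.sqrt x)^-1 ^+ a.
Proof.
move=> x0; rewrite powRB; last by rewrite (gt_eqF x0) implybT.
rewrite powR_sqrt_expr// powRr1 ?(ltW x0)//.
by rewrite exprVn; field; rewrite !gt_eqF ?exprn_gt0 ?sqrtr_gt0.
Qed.

Theorem theorem5 (R : realType) (a : nat) (ha : (0 < a)%N)
    (f : nat -> R)
    (hf_pos : forall n : nat, (0 < n)%N -> 0 < f n)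
    (hf_o : f =o_\oo (fun n : nat => n%:R `^ (- (3 / 2)) : R))
    (d : nat -> measure_display) (T : forall n : nat, measurableType (d n))
    (P : forall n : nat, probability (T n) R)
    (U : forall n : nat, 'I_n -> {RV (P n) >-> R})
    (hU_unif : forall (n : nat) (i : 'I_n), uniform01 (U n i))
    (hU_indep : forall n : nat, mutually_independent (U n)) :
  (fun n : nat =>
     fine (expected_min_cost a (1 / (2 * n%:R) + f n / 2) (U n)))
    \is 'Theta_\oo (fun n : nat => 1 / n%:R `^ (a%:R / 2 - 1) : R).
Proof.
have [C C0 upper] := expected_min_cost_upper R ha.
(* The little-o hypothesis is used with this one constant, the one in the smallness condition of the
   lower bound. *)
have eps0 : 0 < 1024^-1 :> R by lra.
have fsmall := (eqoP _ _ _).1 hf_o _ eps0.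
rewrite qualifE; apply/asboolP.
have c0 : 0 < 256^-1 ^+ a / 4 :> R.
  by apply: divr_gt0; [apply: exprn_gt0|]; lra.
exists (256^-1 ^+ a / 4, C) => /=; first by rewrite c0 C0.
have [N N512] : exists N : nat, 512 * 512 <= N%:R :> R.
  by exists (Num.truncn (512 * 512 : R)).+1; apply/ltW/truncnS_gt.
near=> n.
have : (N <= n)%N by near: n; exact: nbhs_infty_ge.
rewrite -(ler_nat R) => /(le_trans N512) n512.
have n4 : (4 <= n)%N by rewrite -(ler_nat R); lra.
have n0 : (0 < n)%N by apply: leq_trans n4.
have n0R : 0 < n%:R :> R by rewrite ltr0n.
have fn : `|f n| <= 1024^-1 * `|(n%:R : R) `^ (- (3 / 2))| by near: n.
have f0 := hf_pos n n0.
pose q : R := Num.sqrt n%:R.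
have q0 : 0 < q by rewrite sqrtr_gt0.
have q2 : q ^+ 2 = n%:R by rewrite sqr_sqrtr.
have q512 : 512 <= q.
  rewrite leNgt; apply/negP => q_lt.
  have : 0 < (512 - q) * (512 + q) by apply: mulr_gt0; lra.
  by rewrite -q2 in n512; lra.
have nf : n%:R ^+ 2 * f n <= q / 1024.
  move: fn; rewrite powRN [3 / 2]/(3%:R / 2) powR_sqrt_expr// -/q.
  rewrite (gtr0_norm f0) gtr0_norm ?invr_gt0 ?exprn_gt0// => fn.
  have -> : q / 1024 = n%:R ^+ 2 * (1024^-1 * (q ^+ 3)^-1).
    by rewrite -q2; field; rewrite gt_eqF.
  by rewrite ler_wpM2l// exprn_ge0.
have rn : (2 * n%:R)^-1 <= 1 / (2 * n%:R) + f n / 2 by rewrite mul1r lerDl; lra.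
have := upper _ _ _ _ _ _ (hU_unif n) (hU_indep n) n4 rn.
have := expected_min_cost_lower ha (hU_unif n) (hU_indep n) q512 f0 nf.
rewrite inv_powR_half_sub1// -/q.
have s0 : 0 < n%:R * q^-1 ^+ a by rewrite mulr_gt0// exprn_gt0// invr_gt0.
(* The two bounds exclude infinite values, so [fine] returns the true expectation. *)
case: (expected_min_cost _ _ _) => [E| |]; rewrite ?leye_eq ?leeNy_eq//= !lee_fin => El Eu.
rewrite (gtr0_norm s0) ger0_norm//.
by apply: le_trans El; rewrite mulr_ge0 ?(ltW s0) ?(ltW c0).
Unshelve. all: by end_near.
Qed.
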